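(* Let $\{|k\rangle\}$ be an orthonormal basis of $\mathcal{H}_B$, let $\Gamma=\mathrm{id}\otimes\Gamma_B$ with $\Gamma_B(\sigma)=\sum_k|k\rangle\langle k|\sigma|k\rangle\langle k|$, and let $\Lambda$ be a quantum operation on $\mathcal{H}_A\otimes\mathcal{H}_B$ with $W(\Lambda)=0$ with respect to $\Gamma$ (equivalently $\Lambda\circ\Gamma=\Gamma\circ\Lambda$). Then for every state $\rho$ on $\mathcal{H}_A\otimes\mathcal{H}_B$ (in particular for $\rho=|\Phi_d\rangle\langle\Phi_d|$ with $|\Phi_d\rangle=d^{-1/2}\sum_\alpha|\alpha\rangle\otimes|\alpha\rangle$), the quantum discord of $\Lambda(\rho)$ equals the difference in superdense coding capacity between $\Lambda(\rho)$ and $\Lambda\circ\Gamma(\rho)$: $$Q_z\big(\Lambda(\rho)\big)=F\big(\Lambda(\rho)\big)-F\big(\Lambda\circ\Gamma(\rho)\big).$$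
   Context: $\mathcal{H}_A,\mathcal{H}_B$ are finite-dimensional, $d_A=\dim\mathcal{H}_A$; a quantum operation is a completely positive trace-preserving linear map; $S(\rho)=-\mathrm{Tr}[\rho\log_2\rho]$ is the von Neumann entropy. For a state $\rho$ on $\mathcal{H}_A\otimes\mathcal{H}_B$ the conditional entropy is $S(\rho^{A|B})=S(\rho)-S(\mathrm{Tr}_A\rho)$. The superdense coding capacity (Alice encodes and sends her part to Bob) is $F(\rho)=\log_2(d_A)-S(\rho^{A|B})$. The quantum discord (Zurek's original definition, for the measurement of $B$ in the fixed basis $\{|k\rangle\}$) is $$Q_z(\rho)=\sum_k p_k\,S(\rho_k^A)-S(\rho^{A|B}),$$ where $p_k=\mathrm{Tr}[(\mathbf{1}\otimes|k\rangle\langle k|)\rho]$ and $\rho_k^A=\mathrm{Tr}_B[(\mathbf{1}\otimes|k\rangle\langle k|)\rho(\mathbf{1}\otimes|k\rangle\langle k|)]/p_k$ (terms with $p_k=0$ are omitted). The quantumness is $W(\Lambda)=\sup_\rho S\big(\Lambda\circ\Gamma(\rho)\,\|\,\Gamma\circ\Lambda(\rho)\big)$ over all states $\rho$, with $S(\rho\|\sigma)=\mathrm{Tr}[\rho(\log_2\rho-\log_2\sigma)]$ the relative entropy ($+\infty$ if the support of $\rho$ is not contained in that of $\sigma$). *)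

(* Defs.v *)
From HB Require Import structures.
From mathcomp Require Import all_boot all_order all_algebra.
From mathcomp Require Import boolp classical_sets reals ereal exp.
From mathcomp Require Import complex mxtens.

Set Implicit Arguments.
Unset Strict Implicit.
Unset Printing Implicit Defensive.

Import Order.TTheory GRing.Theory Num.Theory.
Local Open Scope ring_scope.
Local Open Scope complex_scope.
Local Open Scope sesquilinear_scope.

(* Operators on C^n are n x n matrices over R[i] acting on column vectors.
   C^dA (x) C^dB is C^(dA * dB), with |i> (x) |j> at position
   mxtens_index (i, j), so that the Kronecker product *t of the real-closed
   library is the tensor product of vectors and of operators.                 *)

Notation "A *t B" := (tensmx A B)
  (at level 40, left associativity, format "A  *t  B") : ring_scope.

Section Operators.
Context {R : realType}.
Local Notation C := R[i].

(* |v><v| *)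
Definition ketbra n (v : 'cV[C]_n) : 'M[C]_n := v *m v^t*.

Definition orthonormal_basis d n (e : 'I_d -> 'cV[C]_n) : Prop :=
  (forall j k, (e j)^t* *m e k = (j == k)%:R%:M)
  /\ row_full (\matrix_k (e k)^T).

Definition psdmx n (A : 'M[C]_n) : Prop :=
  A \is hermsymmx /\ forall v : 'cV[C]_n, 0 <= (v^t* *m A *m v) 0 0.

Definition density n (rho : 'M[C]_n) : Prop := psdmx rho /\ \tr rho = 1.

(* id (x) f on operators on C^k (x) C^n, for a linear f: f is applied to each
   of the k * k blocks of size n x n.                                         *)
Definition id_tens k n (f : 'M[C]_n -> 'M[C]_n) (X : 'M[C]_(k * n)) :
    'M[C]_(k * n) :=
  \matrix_(i, j)
    f (\matrix_(p, q) X (mxtens_index ((mxtens_unindex i).1, p))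
                        (mxtens_index ((mxtens_unindex j).1, q)))
      (mxtens_unindex i).2 (mxtens_unindex j).2.

Definition completely_positive n (f : 'M[C]_n -> 'M[C]_n) : Prop :=
  forall k (X : 'M[C]_(k * n)), psdmx X -> psdmx (id_tens f X).

Definition trace_preserving n (f : 'M[C]_n -> 'M[C]_n) : Prop :=
  forall X, \tr (f X) = \tr X.

Definition quantum_operation n (f : {linear 'M[C]_n -> 'M[C]_n}) : Prop :=
  completely_positive f /\ trace_preserving f.

Definition ptraceA dA dB (X : 'M[C]_(dA * dB)) : 'M[C]_dB :=
  \matrix_(p, q) \sum_(i < dA) X (mxtens_index (i, p)) (mxtens_index (i, q)).

Definition ptraceB dA dB (X : 'M[C]_(dA * dB)) : 'M[C]_dA :=
  \matrix_(i, j) \sum_(p < dB) X (mxtens_index (i, p)) (mxtens_index (j, p)).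

End Operators.

Section Entropies.
Context {R : realType}.
Local Notation C := R[i].

(* ln is 0 outside of the positive reals, hence so is log2. *)
Definition log2 (x : R) : R := ln x / ln 2.

(* Logarithm of a positive semidefinite operator on its support, extended by 0
   on its kernel (so that 0 log 0 = 0): the eigenvalues are mapped by log2 in
   the spectral decomposition A = P^-1 diag(lambda) P.                        *)
Definition log2mx n (A : 'M[C]_n) : 'M[C]_n :=
  invmx (spectralmx A)
  *m diag_mx (map_mx (fun z => (log2 (complex.Re z))%:C) (spectral_diag A))
  *m spectralmx A.

Definition entropy n (rho : 'M[C]_n) : R :=
  - complex.Re (\tr (rho *m log2mx rho)).

(* The support of a Hermitian operator is its range, i.e. its column space;
   (_ <= _)%MS compares row spaces, whence the transpositions.                *)
Definition rel_entropy n (rho sigma : 'M[C]_n) : \bar R :=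
  if (rho^T <= sigma^T)%MS
  then (complex.Re (\tr (rho *m (log2mx rho - log2mx sigma))))%:E
  else +oo%E.

Definition cond_entropy dA dB (rho : 'M[C]_(dA * dB)) : R :=
  entropy rho - entropy (ptraceA rho).

Definition superdense_capacity dA dB (rho : 'M[C]_(dA * dB)) : R :=
  log2 dA%:R - cond_entropy rho.

Section MeasuredBasis.
Context {dA dB : nat} (e : 'I_dB -> 'cV[C]_dB).

(* 1 (x) |k><k| *)
Definition local_proj (k : 'I_dB) : 'M[C]_(dA * dB) := 1%:M *t ketbra (e k).

Definition outcome_prob (rho : 'M[C]_(dA * dB)) (k : 'I_dB) : R :=
  complex.Re (\tr (local_proj k *m rho)).

Definition post_state (rho : 'M[C]_(dA * dB)) (k : 'I_dB) : 'M[C]_dA :=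
  ((outcome_prob rho k)^-1)%:C
  *: ptraceB (local_proj k *m rho *m local_proj k).

Definition discord (rho : 'M[C]_(dA * dB)) : R :=
  \sum_(k < dB | outcome_prob rho k != 0)
     outcome_prob rho k * entropy (post_state rho k)
  - cond_entropy rho.

Definition dephasingB (sigma : 'M[C]_dB) : 'M[C]_dB :=
  \sum_(k < dB) ketbra (e k) *m sigma *m ketbra (e k).

Definition dephasing (rho : 'M[C]_(dA * dB)) : 'M[C]_(dA * dB) :=
  id_tens dephasingB rho.

Definition quantumness (L : 'M[C]_(dA * dB) -> 'M[C]_(dA * dB)) : \bar R :=
  ereal_sup [set rel_entropy (L (dephasing rho)) (dephasing (L rho))
            | rho in [set rho | density rho]].

End MeasuredBasis.

Definition maximally_entangled d dA dB
    (a : 'I_d -> 'cV[C]_dA) (b : 'I_d -> 'cV[C]_dB) : 'cV[C]_(dA * dB) :=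
  ((Num.sqrt (d%:R : R))^-1)%:C *: \sum_(i < d) (a i *t b i : 'cV[C]_(dA * dB)).

End Entropies.

(* Main.v *)
Require Import Defs.
From HB Require Import structures.
From mathcomp Require Import all_boot all_order all_algebra.
From mathcomp Require Import boolp classical_sets reals ereal exp.
From mathcomp Require Import complex mxtens.
From mathcomp Require Import ring lra.

(** Klein's inequality is applied termwise: for rho = sum_i p_i |u_i><u_i| and
    sigma = sum_j q_j |v_j><v_j|, the quantity ln 2 * S(rho || sigma) is the sum
    of |<u_i|v_j>|^2 (p_i (ln p_i - ln q_j) - (p_i - q_j)), whose terms are
    nonnegative and vanish only if <u_i|v_j> = 0 or p_i = q_j.  Hence
    S(rho || sigma) <= 0 forces rho = sigma, and as the densities span all
    operators, a vanishing quantumness means that L commutes with the dephasing.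

    For a state sigma, write tau_k = <k|sigma|k>.  The dephased state is
    sum_k tau_k (x) |k><k|, of entropy sum_k S(tau_k), and its B-marginal is
    sum_k p_k |k><k| with p_k = tr tau_k.  Since p_k S(tau_k / p_k) =
    S(tau_k) + p_k log p_k, the average conditional entropy in the discord of
    sigma is the conditional entropy of the dephased state. *)

Set Implicit Arguments.
Unset Strict Implicit.
Unset Printing Implicit Defensive.

Import Order.TTheory GRing.Theory Num.Theory.
Local Open Scope ring_scope.
Local Open Scope complex_scope.
Local Open Scope sesquilinear_scope.

(** * Conjugate transposes and unitary matrices *)

Section Adjoint.
Variable C : numClosedFieldType.

Lemma trmxC_mul m n p (A : 'M[C]_(m, n)) (B : 'M_(n, p)) :
  (A *m B)^t* = B^t* *m A^t*.
Proof. by rewrite trmx_mul map_mxM. Qed.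

Lemma trmxC_tens m n p q (A : 'M[C]_(m, n)) (B : 'M_(p, q)) :
  (A *t B)^t* = A^t* *t B^t*.
Proof. by rewrite trmx_tens map_mxT. Qed.

Lemma trmxCZ m n a (A : 'M[C]_(m, n)) : (a *: A)^t* = Num.conj a *: A^t*.
Proof. by apply/matrixP => i j; rewrite !mxE rmorphM. Qed.

Lemma hermsymmxP n (A : 'M[C]_n) : reflect (A^t* = A) (A \is hermsymmx).
Proof.
by apply: (iffP (is_hermitianmxP _ _ _)); rewrite expr0 scale1r => /esym.
Qed.

Lemma unitarymx_trmxCl n (P : 'M[C]_n) : P \is unitarymx -> P^t* *m P = 1%:M.
Proof. by rewrite -trmxC_unitary => /unitarymxP; rewrite trmxCK. Qed.

End Adjoint.

(** * Functional calculus in an arbitrary eigenbasis *)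

Section SpectralCalculus.
Variable R : realType.
Local Notation C := R[i].

Lemma conjC_real (x : R) : Num.conj (x%:C : C) = x%:C.
Proof. exact: conjc_real. Qed.

Definition rdiag n (d : 'I_n -> R) : 'M[C]_n := diag_mx (\row_i (d i)%:C).

(** For unitary [P] this is a spectral decomposition whose eigenvectors are the columns of [P^t*],
    the convention of [spectralmx]; a real [d] keeps entropies in [R]. *)
Definition unidiag n (P : 'M[C]_n) (d : 'I_n -> R) : 'M[C]_n :=
  P^t* *m rdiag d *m P.

Lemma rdiag_mull m n (d : 'I_m -> R) (W : 'M_(m, n)) i j :
  (rdiag d *m W) i j = (d i)%:C * W i j.
Proof. by rewrite mul_diag_mx !mxE. Qed.

Lemma rdiag_mulr m n (d : 'I_n -> R) (W : 'M_(m, n)) i j :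
  (W *m rdiag d) i j = W i j * (d j)%:C.
Proof. by rewrite mul_mx_diag !mxE. Qed.

Lemma rdiag_trmxC n (d : 'I_n -> R) : (rdiag d)^t* = rdiag d.
Proof.
rewrite /rdiag tr_diag_mx map_diag_mx; congr diag_mx.
by apply/rowP => i; rewrite !mxE; exact: conjC_real.
Qed.

Lemma unidiag_trmxC n (P : 'M[C]_n) d : (unidiag P d)^t* = unidiag P d.
Proof. by rewrite /unidiag !trmxC_mul trmxCK rdiag_trmxC mulmxA. Qed.

(** Entrywise the hypothesis reads [p i = q j] wherever [W i j] is nonzero, and [f] preserves such
    equalities. *)
Lemma rdiag_comp_intertwine m n (f : R -> R) (p : 'I_m -> R) (q : 'I_n -> R)
    (W : 'M[C]_(m, n)) :
  rdiag p *m W = W *m rdiag q ->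
  rdiag (f \o p) *m W = W *m rdiag (f \o q).
Proof.
move=> pWq; apply/matrixP => i j; rewrite rdiag_mull rdiag_mulr [RHS]mulrC.
have /matrixP/(_ i j) := pWq; rewrite rdiag_mull rdiag_mulr [in X in _ =
  X]mulrC.
have [->|Wn0] := eqVneq (W i j) 0.
  by rewrite !mulr0.
by move=> /(mulIf Wn0) /(@complexI R) /= <-.
Qed.

Lemma unidiag_intertwineP n (P Q : 'M[C]_n) p q :
  P \is unitarymx -> Q \is unitarymx ->
  unidiag P p = unidiag Q q <->
  rdiag p *m (P *m Q^t*) = (P *m Q^t*) *m rdiag q.
Proof.
move=> uP uQ; split=> [|eqW].
  move/(congr1 (fun X => P *m X *m Q^t*)); rewrite /unidiag !mulmxA.
  by rewrite (unitarymxP uP) mul1mx mulmxtVK // !mulmxA.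
have := congr1 (fun X => P^t* *m X *m Q) eqW; rewrite /unidiag !mulmxA.
by rewrite (unitarymx_trmxCl uP) mul1mx (mulmxKtV _ uQ (erefl n)).
Qed.

(** Functional calculus is independent of the chosen diagonalization; [log2mx], defined through
    [spectralmx], can therefore be computed in any eigenbasis. *)
Lemma unidiag_comp n (f : R -> R) (P Q : 'M[C]_n) p q :
  P \is unitarymx -> Q \is unitarymx -> unidiag P p = unidiag Q q ->
  unidiag P (f \o p) = unidiag Q (f \o q).
Proof.
move=> uP uQ /(unidiag_intertwineP _ _ uP uQ).1 eqW.
exact/(unidiag_intertwineP _ _ uP uQ).2/rdiag_comp_intertwine.
Qed.

Lemma hermitian_unidiag n (A : 'M[C]_n) : A \is hermsymmx ->
  let d i := complex.Re (spectral_diag A 0 i) in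
  A = unidiag (spectralmx A) d.
Proof.
move=> hA d; have dE : \row_i (d i)%:C = spectral_diag A.
  apply/rowP => i; rewrite mxE RRe_real //.
  by have /mxOverP := hermitian_spectral_diag_real hA; apply.
rewrite /unidiag /rdiag dE -(invmx_unitary (spectral_unitarymx A)).
exact/orthomx_spectralP/hermitian_normalmx.
Qed.

Lemma log2mx_unidiag n (P : 'M[C]_n) d : P \is unitarymx ->
  log2mx (unidiag P d) = unidiag P (@log2 R \o d).
Proof.
move=> uP; have hA : unidiag P d \is hermsymmx.
  exact/hermsymmxP/unidiag_trmxC.
rewrite [RHS](unidiag_comp _ uP (spectral_unitarymx _) (hermitian_unidiag hA)).
rewrite /log2mx (invmx_unitary (spectral_unitarymx _)).
set r := (X in diag_mx X); have -> : r = \row_i (log2 (complex.Re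
    (spectral_diag (unidiag P d) 0 i)))%:C by apply/rowP => i; rewrite !mxE.
exact: erefl.
Qed.

(* |<u_i|v_j>|^2 for the rows u_i, v_j of P, Q *)
Definition overlap n (P Q : 'M[C]_n) i j : R :=
  complex.Re (`|(P *m Q^t*) i j| ^+ 2).

Lemma overlapE n (P Q : 'M[C]_n) i j :
  (overlap P Q i j)%:C = (P *m Q^t*) i j * Num.conj ((P *m Q^t*) i j).
Proof. by rewrite /overlap RRe_real ?normCK // ger0_real // mul_conjC_ge0. Qed.

Lemma overlap_ge0 n (P Q : 'M[C]_n) i j : 0 <= overlap P Q i j.
Proof. by rewrite -ler0c overlapE -normCK exprn_ge0. Qed.

Lemma overlap_eq0 n (P Q : 'M[C]_n) i j :
  overlap P Q i j = 0 -> (P *m Q^t*) i j = 0.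
Proof.
move/(congr1 (fun x => x%:C)); rewrite overlapE -normCK => /eqP.
by rewrite expf_eq0 normr_eq0 => /eqP.
Qed.

Lemma mxtrace_unidiag_mul n (P Q : 'M[C]_n) p q :
  \tr (unidiag P p *m unidiag Q q) =
  (\sum_i \sum_j overlap P Q i j * (p i * q j))%:C.
Proof.
rewrite /unidiag !mulmxA mxtrace_mulC !mulmxA.
have -> : Q *m P^t* *m rdiag p *m P *m Q^t* *m rdiag q =
  ((P *m Q^t*)^t* *m rdiag p) *m ((P *m Q^t*) *m rdiag q).
  by rewrite trmxC_mul [Q^t*^t*]trmxCK !mulmxA.
rewrite mxtrace_mulC /mxtrace rmorph_sum; apply: eq_bigr => i _.
rewrite mxE rmorph_sum; apply: eq_bigr => j _.
rewrite 2!rdiag_mulr !mxE rmorphM rmorphM /= overlapE !mxE; ring.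
Qed.

Lemma overlap_id n (P : 'M[C]_n) i j :
  P \is unitarymx -> overlap P P i j = (i == j)%:R.
Proof.
move=> uP; apply: complexI; rewrite overlapE (unitarymxP uP) !mxE.
by case: eqP => _; rewrite ?mulr1n ?mulr0n ?mul0r ?conjC1 ?mulr1.
Qed.

(** Row [i] of the unitary [P *m Q^t*] is a unit vector. Together with [overlapC] this makes the
    overlaps a doubly stochastic matrix. *)
Lemma sum_overlapl n (P Q : 'M[C]_n) i :
  P \is unitarymx -> Q \is unitarymx -> \sum_j overlap P Q i j = 1.
Proof.
move=> uP uQ; apply: complexI; rewrite rmorph_sum.
have uQ' : Q^t* \is unitarymx by rewrite trmxC_unitary.
have /unitarymxP/matrixP/(_ i i) := mul_unitarymx uP uQ'.
rewrite mxE [RHS]mxE eqxx => sumW; rewrite -[RHS]sumW.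
by apply: eq_bigr => j _; rewrite /= overlapE !mxE.
Qed.

Lemma overlapC n (P Q : 'M[C]_n) i j : overlap P Q i j = overlap Q P j i.
Proof.
rewrite /overlap; congr (complex.Re (_ ^+ 2)).
by rewrite -norm_conjC -[Q *m _]trmxCK trmxC_mul trmxCK !mxE norm_conjC.
Qed.

Lemma mxtrace_unidiag n (P : 'M[C]_n) d : P \is unitarymx ->
  \tr (unidiag P d) = (\sum_i d i)%:C.
Proof.
move=> uP; rewrite /unidiag -mulmxA mxtrace_mulC -mulmxA (unitarymxP uP).
by rewrite mulmx1 mxtrace_diag rmorph_sum; apply: eq_bigr => i _; rewrite mxE.
Qed.

Lemma entropy_unidiag n (P : 'M[C]_n) d : P \is unitarymx ->
  entropy (unidiag P d) = - \sum_i d i * log2 (d i).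
Proof.
move=> uP; rewrite /entropy log2mx_unidiag // mxtrace_unidiag_mul /=.
congr (- _); apply: eq_bigr => i _; rewrite (bigD1 i) //= big1 => [|j ji].
  by rewrite addr0 overlap_id // eqxx mul1r.
by rewrite overlap_id // eq_sym (negPf ji) mul0r.
Qed.

(** * Positive semidefinite operators, and the span of the densities *)

Lemma psd_gram m n (B : 'M[C]_(m, n)) : psdmx (B^t* *m B).
Proof.
split=> [|v]; first by apply/hermsymmxP; rewrite trmxC_mul trmxCK.
rewrite mulmxA -trmxC_mul -mulmxA mxE; apply: sumr_ge0 => i _.
by rewrite !mxE mulrC mul_conjC_ge0.
Qed.

Lemma unidiag_gram n (P : 'M[C]_n) d : (forall i, 0 <= d i) ->
  unidiag P d = (rdiag (Num.sqrt \o d) *m P)^t* *m (rdiag (Num.sqrt \o d) *m P).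
Proof.
move=> d_ge0; rewrite trmxC_mul rdiag_trmxC /unidiag !mulmxA.
set s := rdiag (Num.sqrt \o d); have <- : s *m s = rdiag d;
  last by rewrite !mulmxA.
apply/matrixP => i j; rewrite rdiag_mull !mxE mulrnAr; case: eqP => // ->.
by rewrite !mulr1n -rmorphM -expr2 /= sqr_sqrtr.
Qed.

Lemma psd_unidiag n (P : 'M[C]_n) d :
  (forall i, 0 <= d i) -> psdmx (unidiag P d).
Proof. by move=> /unidiag_gram ->; exact: psd_gram. Qed.

Lemma psdmx_unidiag n (A : 'M[C]_n) : psdmx A ->
  exists P d, [/\ P \is unitarymx, forall i, 0 <= d i & A = unidiag P d].
Proof.
case=> hA A_ge0; have eA := hermitian_unidiag hA.
eexists; eexists; split; [exact: spectral_unitarymx| |exact: eA].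
move=> i; move: eA; set P := spectralmx A => eA /=.
have uP : P \is unitarymx by exact: spectral_unitarymx.
set d := (fun i => _) in eA; rewrite -ler0c -/(d i).
(* The test vector is the eigenvector for [d i], so the quadratic form returns [d i] itself. *)
have := A_ge0 (P^t* *m delta_mx i 0).
rewrite eA /unidiag trmxC_mul trmxCK !mulmxA.
rewrite -(mulmxA _ P) (unitarymxP uP) mulmx1 -(mulmxA _ P) (unitarymxP uP).
rewrite mulmx1 -mulmxA mxE (bigD1 i) //= big1 => [|j ji].
  by rewrite addr0 rdiag_mull !mxE !eqxx /= conjC1 mul1r mulr1.
by rewrite !mxE (negPf ji) /= conjC0 mul0r.
Qed.

Lemma psdmx_gram n (A : 'M[C]_n) : psdmx A -> exists B : 'M_n, A = B^t* *m B.
Proof.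
by case/psdmx_unidiag=> P [d [_ d_ge0 ->]]; eexists; exact: unidiag_gram.
Qed.

Lemma psdmxD n (A B : 'M[C]_n) : psdmx A -> psdmx B -> psdmx (A + B).
Proof.
move=> [/hermsymmxP hA A0] [/hermsymmxP hB B0]; split=> [|v].
  by apply/hermsymmxP; rewrite linearD map_mxD /= hA hB.
by rewrite mulmxDr mulmxDl mxE addr_ge0.
Qed.

Lemma psdmx0 n : psdmx (0 : 'M[C]_n).
Proof. by have := psd_gram (0 : 'M[C]_n); rewrite mulmx0. Qed.

Lemma psdmx_sum n (I : Type) (r : seq I) (F : I -> 'M[C]_n) :
  (forall i, psdmx (F i)) -> psdmx (\sum_(i <- r) F i).
Proof.
by move=> F0; elim/big_ind: _ => [|A B|i _]; [exact: psdmx0|exact: psdmxD|].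
Qed.

Lemma psdmx_tens m n (A : 'M[C]_m) (B : 'M[C]_n) :
  psdmx A -> psdmx B -> psdmx (A *t B).
Proof.
move=> /psdmx_gram[A' ->] /psdmx_gram[B' ->].
by rewrite -tensmx_mul -trmxC_tens; exact: psd_gram.
Qed.

Lemma psdmx_ketbra n (v : 'cV[C]_n) : psdmx (ketbra v).
Proof. by rewrite /ketbra -{1}[v]trmxCK; exact: psd_gram. Qed.

Lemma psdmx1 n : psdmx (1%:M : 'M[C]_n).
Proof.
by have := psd_gram (1%:M : 'M[C]_n); rewrite trmx1 map_mx1 mulmx1.
Qed.

Lemma unidiagZ n a (P : 'M[C]_n) d :
  a%:C *: unidiag P d = unidiag P (fun i => a * d i).
Proof.
have aE : a%:C *: rdiag d = rdiag (fun i => a * d i); last first.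
  by rewrite /unidiag -aE -scalemxAr -scalemxAl.
by apply/matrixP => i j; rewrite !mxE rmorphM mulrnAr.
Qed.

Lemma unidiagD n (P : 'M[C]_n) c d :
  unidiag P c + unidiag P d = unidiag P (fun i => c i + d i).
Proof.
have cdE : rdiag c + rdiag d = rdiag (fun i => c i + d i); last first.
  by rewrite /unidiag -cdE mulmxDr mulmxDl.
by apply/matrixP => i j; rewrite !mxE rmorphD mulrnDl.
Qed.

Lemma unidiag0 n (P : 'M[C]_n) : unidiag P (fun=> 0) = 0.
Proof.
have := unidiagZ 0 P (fun=> 0); rewrite scale0r mul0r; exact: esym.
Qed.

(* Densities span: split X into its Hermitian and anti-Hermitian parts, and
   these into their positive and negative parts. *)
Lemma density_ind n (T : 'M[C]_n -> Prop) : (0 < n)%N ->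
  (forall a X Y, T X -> T Y -> T (a *: X + Y)) ->
  (forall rho, density rho -> T rho) -> forall X, T X.
Proof.
move=> n_gt0 T_lin T_density.
pose i0 := Ordinal n_gt0.
(* Zero is obtained as [- rho + rho], which requires some density; positive dimension provides a
   basis projector. *)
have T0 : T 0.
  suff dE : density (ketbra (delta_mx i0 0 : 'cV[C]_n)).
    by have := T_lin (-1) _ _ (T_density _ dE) (T_density _ dE);
      rewrite scaleN1r addNr.
  split; first exact: psdmx_ketbra.
  rewrite /ketbra trmx_delta map_delta_mx mul_delta_mx /mxtrace (bigD1 i0) //=.
  rewrite mxE !eqxx big1 ?addr0 // => i ne; by rewrite mxE (negPf ne).
have TZ a X : T X -> T (a *: X) by move=> TX; rewrite -[_ *: _]addr0;
  exact: T_lin.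
have T_psd A : psdmx A -> T A.
  case/psdmx_unidiag=> P [d [uP d_ge0 ->]].
  (* A positive operator of trace zero vanishes; any other is its trace times a density. *)
  have [d0|d_n0] := eqVneq (\sum_i d i) 0.
    suff -> : unidiag P d = unidiag P (fun=> 0) by rewrite unidiag0.
    by congr unidiag; apply/funext => i;
      exact: (psumr_eq0P (fun k _ => d_ge0 k) d0).
  have -> : unidiag P d = (\sum_i d i)%:C *: unidiag P (fun i =>
    (\sum_i d i)^-1 * d i).
    by rewrite unidiagZ; congr unidiag; apply/funext => i; rewrite mulVKf.
  apply/TZ/T_density; split.
    by apply: psd_unidiag => i; rewrite mulr_ge0 // invr_ge0 sumr_ge0.
  by rewrite mxtrace_unidiag // -mulr_sumr mulVf.
have T_herm A : A \is hermsymmx -> T A.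
  move=> /hermitian_unidiag; set P := spectralmx A; set d := (fun _ => _) => ->.
  have -> : unidiag P d = (-1) *: unidiag P (fun i => Num.max (- d i) 0)
      + unidiag P (fun i => Num.max (d i) 0).
    rewrite -(rmorphN1 (real_complex R)) unidiagZ unidiagD; congr unidiag.
    apply/funext => i; case: (lerP (d i) 0) => d0;
      case: (lerP (- d i) 0) => d0'; lra.
  by apply: T_lin; apply/T_psd/psd_unidiag => i; rewrite le_max lexx orbT.
move=> X.
(* Multiplying the anti-Hermitian [X - X^t*] by ['i] makes it Hermitian; the outer coefficient turns
   that ['i] into [1/2]. *)
have -> : X = 2^-1 *: (X + X^t*) + (- ('i%C / 2)) *: ('i%C *: (X - X^t*)).
  apply/matrixP => i j; rewrite !mxE mulrA.
  have -> : - ('i%C / 2) * 'i%C = 2^-1 :> C by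
    rewrite mulNr mulrAC -expr2 sqr_i mulN1r opprK.
  by rewrite -mulrDr addrACA subrr addr0; field.
apply: T_lin; [|apply: TZ]; apply: T_herm; apply/hermsymmxP.
  by rewrite linearD map_mxD trmxCK addrC.
apply/matrixP => i j; rewrite !mxE rmorphM rmorphB /= conjCK.
have -> : Num.conj ('i%C : C) = - 'i%C.
  by apply/eqP; rewrite eq_complex /= oppr0 !eqxx.
by rewrite mulNr -mulrN opprB.
Qed.

End SpectralCalculus.

(** * Klein's inequality and its equality case *)

Section Klein.
Variable R : realType.
Local Notation C := R[i].

Definition klein_gap (p q : R) : R := p * (ln p - ln q) - (p - q).

(* ln (q / p) <= q / p - 1, strictly unless q = p *)
Lemma klein_gapP (p q : R) : 0 <= p -> 0 <= q -> (q = 0 -> p = 0) ->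
  0 <= klein_gap p q /\ (klein_gap p q = 0 -> p = q).
Proof.
rewrite /klein_gap le0r => /predU1P[-> q0 _|p_gt0].
  rewrite mul0r !sub0r opprK; split=> [//|->//].
rewrite le0r => /predU1P[->|q_gt0 _]; first by move=> /(_ erefl) ->; split; lra.
have pNq0 : p != q -> 0 < p * (ln p - ln q) - (p - q).
  move=> pq; have : ln q - ln p != 0.
    by rewrite subr_eq0; apply: contra pq => /eqP /ln_inj ->.
  move=> /expR_gt1Dx; rewrite -ln_div ?posrE // lnK ?posrE ?divr_gt0 //.
  rewrite ln_div ?posrE // ltr_pdivlMr // => lt; nra.
split; last by move=> g0; apply/eqP; apply: contraT => /pNq0; rewrite g0 ltxx.
have [->|/pNq0/ltW//] := eqVneq p q; lra.
Qed.

Lemma ln2_gt0 : 0 < ln 2 :> R.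
Proof. by rewrite ln_gt0 // ltr1n. Qed.

Lemma density_unidiag n (rho : 'M[C]_n) : density rho ->
  exists P d, [/\ P \is unitarymx, forall i, 0 <= d i, \sum_i d i = 1
    & rho = unidiag P d].
Proof.
case=> /psdmx_unidiag[P [d [uP d0 ->]]].
rewrite mxtrace_unidiag // => /(@complexI R) d1.
by exists P, d.
Qed.

(** Support inclusion factors the first operator as a matrix times the second. Read from the basis
    of [Q] to that of [P], column [j] of the product carries the factor [q j], so [q j = 0] forces
    [p i] times the [(i, j)] entry of [P *m Q^t*] to vanish. *)
Lemma support_unidiag n (P Q : 'M[C]_n) p q :
  P \is unitarymx -> Q \is unitarymx ->
  ((unidiag P p)^T <= (unidiag Q q)^T)%MS ->
  forall i j, q j = 0 -> overlap P Q i j != 0 -> p i = 0.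
Proof.
move=> uP uQ /submxP[D /(congr1 (map_mx Num.conj))].
rewrite map_mxM -!/(_ ^t* ) !unidiag_trmxC => eqD i j q0.
have : rdiag p *m (P *m Q^t*) = (P *m map_mx Num.conj D *m Q^t*) *m rdiag q.
  have := congr1 (fun X => P *m X *m Q^t*) eqD.
  by rewrite /unidiag !mulmxA (unitarymxP uP) mul1mx mulmxtVK.
move=> /matrixP/(_ i j); rewrite rdiag_mull rdiag_mulr q0 mulr0.
move/eqP; rewrite mulf_eq0 => /orP[/eqP/(@complexI R)//|/eqP W0].
by rewrite /overlap W0 normr0 expr0n eqxx.
Qed.

Lemma rel_entropy_self n (rho : 'M[C]_n) : rel_entropy rho rho = 0%E.
Proof. by rewrite /rel_entropy submx_refl subrr mulmx0 mxtrace0. Qed.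

Lemma rel_entropy_unidiag n (P Q : 'M[C]_n) p q :
  P \is unitarymx -> Q \is unitarymx ->
  complex.Re (\tr (unidiag P p *m (log2mx (unidiag P p) - log2mx (unidiag Q
    q))))
  = \sum_i \sum_j overlap P Q i j * (p i * (log2 (p i) - log2 (q j))).
Proof.
move=> uP uQ; have ReB (x y : C) : complex.Re (x - y) =
  complex.Re x - complex.Re y.
  by case: x y => [? ?] [? ?].
rewrite mulmxBr raddfB /= ReB -[X in X - _]opprK.
rewrite [X in - X - _](entropy_unidiag p uP) opprK.
rewrite (log2mx_unidiag q uQ) mxtrace_unidiag_mul /= -sumrB.
apply: eq_bigr => i _.
(* The entropy term, a single sum over [i], is spread over [j] by writing [1] as a row sum of
   overlaps. *)
rewrite -[X in X - _]mul1r -(sum_overlapl i uP uQ) mulr_suml -sumrB.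
by apply: eq_bigr => j _; ring.
Qed.

Lemma rel_entropy_le0_eq n (rho sigma : 'M[C]_n) :
  density rho -> density sigma -> (rel_entropy rho sigma <= 0)%E -> rho = sigma.
Proof.
move=> /density_unidiag[P [p [uP p_ge0 p1 ->]]].
move=> /density_unidiag[Q [q [uQ q_ge0 q1 ->]]].
rewrite /rel_entropy; case: ifPn => // /(support_unidiag uP uQ) supp.
rewrite (rel_entropy_unidiag p q uP uQ) lee_fin => S_le0.
pose G i j := overlap P Q i j * klein_gap (p i) (q j).
have G_ge0 i j : 0 <= G i j.
  rewrite /G; have [->|M0] := eqVneq (overlap P Q i j) 0;
    first by rewrite mul0r.
  rewrite mulr_ge0 ?overlap_ge0 //.
  by have [] := klein_gapP (p_ge0 i) (q_ge0 j) (fun q0 => supp i j q0 M0).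
have sumG : \sum_i \sum_j G i j <= 0.
  have -> : \sum_i \sum_j G i j = ln 2 *
      \sum_i \sum_j overlap P Q i j * (p i * (log2 (p i) - log2 (q j))).
    (* Both traces are [1], so the linear terms of the gaps cancel in total; double stochasticity
       spreads each trace over all pairs [(i, j)]. *)
    have pq0 : \sum_i p i - \sum_i q i = 0 by rewrite p1 q1 subrr.
    rewrite -[RHS]subr0 -[X in _ = _ - X]pq0.
    have -> : \sum_i p i = \sum_i \sum_j overlap P Q i j * p i.
      apply: eq_bigr => i _.
      by rewrite -mulr_suml (sum_overlapl i uP uQ) mul1r.
    have -> : \sum_j q j = \sum_i \sum_j overlap P Q i j * q j.
      rewrite exchange_big; apply: eq_bigr => j _.
      rewrite -mulr_suml (eq_bigr (overlap Q P j)) => [|i _];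
        last exact: overlapC.
      by rewrite (sum_overlapl j uQ uP) mul1r.
    rewrite -sumrB mulr_sumr -sumrB; apply: eq_bigr => i _.
    rewrite -sumrB mulr_sumr -sumrB; apply: eq_bigr => j _.
    rewrite /G /klein_gap /log2; have := lt0r_neq0 ln2_gt0;
      move: (ln 2) => l l0.
    by field.
  by rewrite mulr_ge0_le0 // ltW // ln2_gt0.
have G0 i j : G i j = 0.
  have sumG0 : \sum_i \sum_j G i j = 0.
    apply/eqP; rewrite eq_le sumG /=.
    by apply: sumr_ge0 => k _; apply: sumr_ge0.
  have /(_ i erefl) := psumr_eq0P (fun k _ => sumr_ge0 _ (fun l _ =>
    G_ge0 k l)) sumG0.
  by move=> /(psumr_eq0P (fun l _ => G_ge0 i l)); apply.
(* Equality of the two operators amounts to [p i = q j] at each nonzero entry of [P *m Q^t*], which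
   is the equality case of [klein_gapP]. *)
apply/(unidiag_intertwineP p q uP uQ)/matrixP => i j.
rewrite rdiag_mull rdiag_mulr mulrC.
have [->|W0] := eqVneq ((P *m Q^t*) i j) 0; first by rewrite !mul0r.
have M0 : overlap P Q i j != 0 by apply: contra W0 => /eqP/overlap_eq0/eqP.
have /eqP := G0 i j; rewrite /G mulf_eq0 (negPf M0) /= => /eqP.
by have [_ /[apply] ->] :=
  klein_gapP (p_ge0 i) (q_ge0 j) (fun q0 => supp i j q0 M0).
Qed.

End Klein.

(** * Block structure of tensor products *)

Section Blocks.
Variable R : realType.
Local Notation C := R[i].

Lemma sum_mxtens (V : nmodType) m n (F : 'I_(m * n) -> V) :
  \sum_x F x = \sum_i \sum_p F (mxtens_index (i, p)).
Proof.
rewrite pair_big; rewrite (reindex (@mxtens_index m n)) /=.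
  by apply: eq_bigr => -[].
by exists (@mxtens_unindex m n) => x _; rewrite ?mxtens_indexK ?mxtens_unindexK.
Qed.

Lemma mxtens_indexP2 m n m' n' (A B : 'M[C]_(m * n, m' * n')) :
  (forall i p j q, A (mxtens_index (i, p)) (mxtens_index (j, q))
    = B (mxtens_index (i, p)) (mxtens_index (j, q))) -> A = B.
Proof.
move=> AB; apply/matrixP => x y.
by case: (mxtens_indexP x) => i p; case: (mxtens_indexP y) => j q.
Qed.

Lemma tens11 m n : (1%:M : 'M[C]_m) *t (1%:M : 'M[C]_n) = 1%:M.
Proof.
apply: mxtens_indexP2 => i p j q; rewrite tensmxE !mxE.
by rewrite (can_eq (@mxtens_indexK m n)) xpair_eqE -natrM mulnb.
Qed.

Lemma tensmx_linearl m n p q a (A B : 'M[C]_(m, n)) (M : 'M[C]_(p, q)) :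
  (a *: A + B) *t M = a *: (A *t M) + B *t M.
Proof. by apply/matrixP => x y; rewrite !mxE mulrDl mulrA. Qed.

Lemma mxtrace_tens m n (A : 'M[C]_m) (B : 'M[C]_n) :
  \tr (A *t B) = \tr A * \tr B.
Proof.
rewrite /mxtrace sum_mxtens big_distrlr /=.
by apply: eq_bigr => i _; apply: eq_bigr => p _; rewrite tensmxE.
Qed.

Definition blk m n (X : 'M[C]_(m * n)) i j : 'M[C]_n :=
  \matrix_(p, q) X (mxtens_index (i, p)) (mxtens_index (j, q)).

Lemma mxtrace_blk m n (X : 'M[C]_(m * n)) : \tr X = \sum_i \tr (blk X i i).
Proof.
rewrite /mxtrace sum_mxtens; apply: eq_bigr => i _.
by apply: eq_bigr => p _; rewrite mxE.
Qed.

Lemma blk_mull m n (K : 'M[C]_n) (X : 'M[C]_(m * n)) i j :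
  blk (1%:M *t K *m X) i j = K *m blk X i j.
Proof.
apply/matrixP => p q; rewrite !mxE sum_mxtens (bigD1 i) //= [X in _ + X]big1
  => [|k ki].
  rewrite addr0; apply: eq_bigr => r _; by rewrite tensmxE !mxE eqxx mul1r.
by apply: big1 => r _; rewrite tensmxE mxE eq_sym (negPf ki) !mul0r.
Qed.

Lemma blk_mulr m n (K : 'M[C]_n) (X : 'M[C]_(m * n)) i j :
  blk (X *m (1%:M *t K)) i j = blk X i j *m K.
Proof.
apply/matrixP => p q; rewrite !mxE sum_mxtens (bigD1 j) //= [X in _ + X]big1
  => [|k kj].
  rewrite addr0; apply: eq_bigr => r _; by rewrite tensmxE !mxE eqxx mul1r.
by apply: big1 => r _; rewrite tensmxE mxE (negPf kj) mul0r mulr0.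
Qed.

Lemma ptraceA_blk m n (X : 'M[C]_(m * n)) : ptraceA X = \sum_i blk X i i.
Proof.
by apply/matrixP => p q; rewrite mxE summxE; apply: eq_bigr => i _; rewrite mxE.
Qed.

Lemma ptraceB_blk m n (X : 'M[C]_(m * n)) i j : ptraceB X i j = \tr (blk X i j).
Proof. by rewrite mxE; apply: eq_bigr => p _; rewrite mxE. Qed.

Lemma blk_tens m n (A : 'M[C]_m) (B : 'M[C]_n) i j :
  blk (A *t B) i j = A i j *: B.
Proof. by apply/matrixP => p q; rewrite mxE tensmxE mxE. Qed.

Lemma blk_sum m n (I : Type) (r : seq I) (F : I -> 'M[C]_(m * n)) i j :
  blk (\sum_(k <- r) F k) i j = \sum_(k <- r) blk (F k) i j.
Proof.
by apply/matrixP => p q; rewrite mxE !summxE; apply: eq_bigr => k _;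
  rewrite mxE.
Qed.

(** The label [k] sits in the second tensor factor, so the operator is block diagonal only after
    exchanging the factors; [blk] instead cuts along the first factor. *)
Definition bdiag m n (A : 'I_n -> 'M[C]_m) : 'M[C]_(m * n) :=
  \sum_k A k *t delta_mx k k.

Lemma bdiagE m n (A : 'I_n -> 'M[C]_m) i p j q :
  bdiag A (mxtens_index (i, p)) (mxtens_index (j, q)) = A p i j *+ (p == q).
Proof.
rewrite /bdiag summxE (bigD1 p) //= big1 => [|k kp]; rewrite tensmxE mxE.
  by rewrite eqxx addr0 mulr_natr eq_sym.
by rewrite [p == k]eq_sym (negPf kp) mulr0.
Qed.

Lemma bdiag_mul m n (A B : 'I_n -> 'M[C]_m) :
  bdiag A *m bdiag B = bdiag (fun k => A k *m B k).
Proof.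
rewrite /bdiag mulmx_suml; apply: eq_bigr => k _.
rewrite mulmx_sumr (bigD1 k) //= big1 => [|l lk]; rewrite tensmx_mul.
  by rewrite addr0 mul_delta_mx.
by rewrite mul_delta_mx_0 ?tensmx0 // eq_sym.
Qed.

Lemma bdiag_trmxC m n (A : 'I_n -> 'M[C]_m) :
  (bdiag A)^t* = bdiag (fun k => (A k)^t*).
Proof.
apply: mxtens_indexP2 => i p j q; rewrite mxE mxE !bdiagE rmorphMn !mxE.
by rewrite eq_sym; case: eqP => // ->.
Qed.

Lemma bdiag1 m n : bdiag (fun _ : 'I_n => 1%:M : 'M[C]_m) = 1%:M.
Proof.
apply: mxtens_indexP2 => i p j q; rewrite bdiagE !mxE.
rewrite (can_eq (@mxtens_indexK m n)) xpair_eqE.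
by case: (i == j); case: (p == q).
Qed.

Lemma bdiag_rdiag m n (d : 'I_n -> 'I_m -> R) :
  bdiag (fun k => rdiag (d k)) =
  rdiag (fun x => d (mxtens_unindex x).2 (mxtens_unindex x).1).
Proof.
apply: mxtens_indexP2 => i p j q; rewrite bdiagE !mxE.
rewrite (can_eq (@mxtens_indexK m n)) xpair_eqE mxtens_indexK /=.
by case: (i == j); case: (p == q).
Qed.

(** Positivity is complete positivity with an ancilla of dimension one, carried over to size [n] by
    tensoring with the [1 x 1] identity. *)
Lemma quantum_operation_density n (L : {linear 'M[C]_n -> 'M[C]_n}) rho :
  quantum_operation L -> density rho -> density (L rho).
Proof.
move=> [L_cp L_tp] [rho_psd rho_tr]; split; last by rewrite L_tp.
have id_tens1 : id_tens L (1%:M *t rho) = (1%:M : 'M_1) *t L rho.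
  apply: mxtens_indexP2 => i p j q; rewrite tensmxE !mxE !mxtens_indexK /=.
  rewrite !ord1 eqxx mul1r; congr (L _ p q); apply/matrixP => r s.
  by rewrite mxE tensmxE mxE mul1r.
have := L_cp 1%N _ (psdmx_tens (psdmx1 R 1) rho_psd).
rewrite id_tens1 => -[/hermsymmxP hL L_ge0]; split=> [|v].
  apply/hermsymmxP/matrixP => p q.
  have /matrixP/(_ (mxtens_index (0, p)) (mxtens_index (0, q))) := hL.
  by rewrite trmxC_tens trmx1 map_mx1 !tensmxE !mxE !mul1r.
pose w : 'M[C]_(1 * n, 1 * 1) := (1%:M : 'M_1) *t v.
(* The unique index, written as a tensor index so that [tensmxE] applies. *)
pose z : 'I_(1 * 1) := mxtens_index (0, 0).
have : 0 <= (w^t* *m ((1%:M : 'M_1) *t L rho) *m w) z z.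
  by have -> : z = 0 :> 'I_1; [exact: val_inj | exact: L_ge0].
by rewrite /w trmxC_tens trmx1 map_mx1 !tensmx_mul !mulmx1 tensmxE mxE mul1r.
Qed.

End Blocks.

(** * Dephasing in the measured basis *)

Section Dephasing.
Variables (R : realType) (dA dB : nat).
Local Notation C := R[i].
Variables (e : 'I_dB -> 'cV[C]_dB) (e_basis : orthonormal_basis e).

(** The rows are the bras [<k|], so this unitary sends [e k] to the [k]-th standard vector. *)
Definition basismx : 'M[C]_dB := \matrix_(k, p) Num.conj (e k p 0).

(* <k|X|k>, the unnormalized state of A after outcome k *)
Definition cond_op k (X : 'M[C]_(dA * dB)) : 'M[C]_dA :=
  \matrix_(i, j) ((e k)^t* *m blk X i j *m e k) 0 0.

Lemma basismx_unitary : basismx \is unitarymx.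
Proof.
apply/unitarymxP/matrixP => k l; have := e_basis.1 k l.
move=> /matrixP/(_ 0 0); rewrite !mxE eqxx mulr1n => <-.
by apply: eq_bigr => p _; rewrite !mxE conjCK.
Qed.

Lemma ketbra_basismx k :
  ketbra (e k) = basismx^t* *m delta_mx k k *m basismx.
Proof.
apply/matrixP => p q; rewrite -mulmxA mxE big_ord1 !mxE (bigD1 k) //=.
rewrite big1 => [|l lk]; last first.
  rewrite [X in _ * X]mxE big1 ?mulr0 // => m _.
  by rewrite mxE (negPf lk) mul0r.
rewrite addr0 !mxE conjCK (bigD1 k) //= big1 => [|m mk].
  by rewrite !mxE !eqxx mul1r addr0.
by rewrite mxE (negPf mk) andbF mul0r.
Qed.

Lemma sum_ketbra (t : 'I_dB -> R) :
  \sum_k (t k)%:C *: ketbra (e k) = unidiag basismx t.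
Proof.
rewrite /unidiag /rdiag diag_mx_sum_delta mulmx_sumr mulmx_suml.
apply: eq_bigr => k _.
by rewrite mxE ketbra_basismx -scalemxAr -scalemxAl.
Qed.

Lemma sum_ketbra1 : \sum_k ketbra (e k) = 1%:M.
Proof.
rewrite -(unitarymx_trmxCl basismx_unitary).
transitivity (\sum_k (1%:C : C) *: ketbra (e k)).
  by apply: eq_bigr => k _; rewrite scale1r.
rewrite (sum_ketbra (fun=> 1)) /unidiag; congr (_ *m _).
rewrite -[RHS]mulmx1; congr (_ *m _).
by apply/matrixP => i j; rewrite !mxE.
Qed.

Lemma ketbra_sandwich k (B : 'M[C]_dB) :
  ketbra (e k) *m B *m ketbra (e k) =
  ((e k)^t* *m B *m e k) 0 0 *: ketbra (e k).
Proof.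
transitivity (e k *m ((e k)^t* *m B *m e k) *m (e k)^t*).
  by rewrite /ketbra !mulmxA.
by rewrite [X in _ *m X *m _]mx11_scalar mul_mx_scalar -scalemxAl.
Qed.

Lemma mxtrace_ketbra_mul k (B : 'M[C]_dB) :
  \tr (ketbra (e k) *m B) = ((e k)^t* *m B *m e k) 0 0.
Proof. by rewrite /ketbra -mulmxA mxtrace_mulC trace_mx11. Qed.

Lemma mxtrace_ketbra k : \tr (ketbra (e k)) = 1.
Proof.
rewrite -[ketbra _]mulmx1 mxtrace_ketbra_mul mulmx1 (e_basis.1 k k).
by rewrite !mxE !eqxx.
Qed.

Lemma dephasingE X : dephasing e X = \sum_k cond_op k X *t ketbra (e k).
Proof.
apply: mxtens_indexP2 => i p j q; rewrite mxE !mxtens_indexK /= !summxE.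
apply: eq_bigr => k _; rewrite tensmxE ketbra_sandwich [LHS]mxE.
by rewrite [cond_op _ _ _ _]mxE.
Qed.

(** The quadratic form of [cond_op k X] at [v] is that of [X] at [v *t e k]. *)
Lemma cond_op_psd k X : psdmx X -> psdmx (cond_op k X).
Proof.
case=> /hermsymmxP hX X_ge0; split=> [|v].
  apply/hermsymmxP/matrixP => i j; rewrite 2!mxE [cond_op _ _ _ _]mxE [RHS]mxE.
  have -> : blk X i j = (blk X j i)^t*.
    by apply/matrixP => p q; rewrite !mxE -{1}hX !mxE.
  have -> : (e k)^t* *m (blk X j i)^t* *m e k =
    ((e k)^t* *m blk X j i *m e k)^t*.
    by rewrite !trmxC_mul trmxCK mulmxA.
  by rewrite [RHS]mxE [in RHS]mxE.
pose w : 'M[C]_(dA * dB, 1 * 1) := v *t e k.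
pose z : 'I_(1 * 1) := mxtens_index (0, 0).
suff -> : (v^t* *m cond_op k X *m v) 0 0 = (w^t* *m X *m w) z z.
  by have -> : z = 0 :> 'I_1; [exact: val_inj | exact: X_ge0].
rewrite [RHS]mxE sum_mxtens [LHS]mxE; apply: eq_bigr => j _.
rewrite [X in X * _]mxE mulr_suml.
under [RHS]eq_bigr do rewrite [X in X * _]mxE sum_mxtens mulr_suml.
rewrite exchange_big; apply: eq_bigr => i _ /=.
rewrite [cond_op _ _ _ _]mxE [X in _ * X * _]mxE mulr_sumr mulr_suml.
apply: eq_bigr => q _; rewrite [X in _ * (X * _) * _]mxE !mulr_suml mulr_sumr.
rewrite mulr_suml; apply: eq_bigr => p _.
rewrite /w /z tensmxE trmxC_tens tensmxE [blk _ _ _ _ _]mxE; ring.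
Qed.

Lemma mxtrace_cond_op k X : \tr (cond_op k X) = \tr (local_proj e k *m X).
Proof.
rewrite mxtrace_blk; apply: eq_bigr => i _.
by rewrite blk_mull mxtrace_ketbra_mul mxE.
Qed.

Lemma post_stateE X k :
  post_state e X k = ((outcome_prob e X k)^-1)%:C *: cond_op k X.
Proof.
congr (_ *: _); apply/matrixP => i j.
rewrite ptraceB_blk blk_mulr blk_mull ketbra_sandwich mxtraceZ.
by rewrite mxtrace_ketbra mulr1 [RHS]mxE.
Qed.

Lemma ptraceA_dephasing X :
  ptraceA (dephasing e X) = \sum_k \tr (cond_op k X) *: ketbra (e k).
Proof.
rewrite ptraceA_blk dephasingE.
under eq_bigr do rewrite blk_sum.
rewrite exchange_big; apply: eq_bigr => k _.
by rewrite /mxtrace scaler_suml; apply: eq_bigr => i _; rewrite blk_tens.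
Qed.

(** The projectors resolve the identity, so the traces of the [cond_op k X] add up to that of
    [X]. *)
Lemma mxtrace_dephasing (X : 'M[C]_(dA * dB)) : \tr (dephasing e X) = \tr X.
Proof.
rewrite dephasingE raddf_sum /=.
under eq_bigr do rewrite mxtrace_tens mxtrace_ketbra mulr1 mxtrace_cond_op.
rewrite mxtrace_blk.
under eq_bigr do rewrite mxtrace_blk.
rewrite exchange_big; apply: eq_bigr => i _.
rewrite -[in RHS](mul1mx (blk X i i)) -sum_ketbra1 mulmx_suml raddf_sum.
by apply: eq_bigr => k _; rewrite blk_mull.
Qed.

Lemma dephasing_density (X : 'M[C]_(dA * dB)) :
  density X -> density (dephasing e X).
Proof.
case=> X_psd X_tr; split; last by rewrite mxtrace_dephasing.
rewrite dephasingE; apply: psdmx_sum => k.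
by apply: psdmx_tens; [exact: cond_op_psd | exact: psdmx_ketbra].
Qed.

Lemma dephasing_linear a (X Y : 'M[C]_(dA * dB)) :
  dephasing e (a *: X + Y) = a *: dephasing e X + dephasing e Y.
Proof.
rewrite !dephasingE scaler_sumr -big_split; apply: eq_bigr => k _.
have -> : cond_op k (a *: X + Y) = a *: cond_op k X + cond_op k Y.
  apply/matrixP => i j; rewrite [LHS]mxE.
  have -> : blk (a *: X + Y) i j = a *: blk X i j + blk Y i j.
    by apply/matrixP => p q; rewrite !mxE.
  rewrite mulmxDr mulmxDl -scalemxAr -scalemxAl.
  by rewrite 2!mxE [RHS]mxE [X in _ = X + _]mxE ![cond_op _ _ _ _]mxE.
exact: tensmx_linearl.
Qed.

(** [W] rotates the measured basis to the standard one and [V] then diagonalizes each block. The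
    spectrum is the union, with multiplicity, of the spectra of the [A k], so the entropies add. *)
Lemma entropy_blocks (A : 'I_dB -> 'M[C]_dA) :
  (forall k, psdmx (A k)) ->
  entropy (\sum_k A k *t ketbra (e k)) = \sum_k entropy (A k).
Proof.
move=> A_psd.
have /choice[Pd Pd_spec] k : exists Pd : 'M[C]_dA * ('I_dA -> R),
    Pd.1 \is unitarymx /\ A k = unidiag Pd.1 Pd.2.
  by have [P [d [uP _ ->]]] := psdmx_unidiag (A_psd k); exists (P, d).
pose d x := (Pd (mxtens_unindex x).2).2 (mxtens_unindex x).1.
pose V := bdiag (fun k => (Pd k).1).
pose W : 'M[C]_(dA * dB) := 1%:M *t basismx.
have uV : V \is unitarymx.
  apply/unitarymxP; rewrite /V bdiag_trmxC bdiag_mul -bdiag1; congr bdiag.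
  by apply/funext => k; apply/unitarymxP; case: (Pd_spec k).
have uW : W \is unitarymx.
  apply/unitarymxP; rewrite /W trmxC_tens tensmx_mul trmx1 map_mx1 mulmx1.
  by rewrite (unitarymxP basismx_unitary) tens11.
have -> : \sum_k A k *t ketbra (e k) = unidiag (V *m W) d.
  transitivity (W^t* *m (V^t* *m rdiag d *m V) *m W); last first.
    by rewrite /unidiag trmxC_mul !mulmxA.
  rewrite /d -(bdiag_rdiag (fun k => (Pd k).2)) bdiag_trmxC !bdiag_mul.
  rewrite /bdiag mulmx_sumr mulmx_suml; apply: eq_bigr => k _.
  rewrite /W trmxC_tens trmx1 map_mx1 !tensmx_mul mul1mx mulmx1.
  by rewrite -ketbra_basismx (Pd_spec k).2.
rewrite (entropy_unidiag d (mul_unitarymx uV uW)).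
under [RHS]eq_bigr do rewrite (Pd_spec _).2 (entropy_unidiag _ (Pd_spec _).1).
rewrite sumrN; congr (- _).
rewrite sum_mxtens exchange_big; apply: eq_bigr => k _; apply: eq_bigr => i _.
by rewrite /d mxtens_indexK.
Qed.

End Dephasing.

(** * Discord as a capacity difference, and vanishing quantumness *)

Section Discord.
Variables (R : realType) (dA dB : nat).
Local Notation C := R[i].
Variables (e : 'I_dB -> 'cV[C]_dB) (e_basis : orthonormal_basis e).

Lemma psdmx_trace_real n (A : 'M[C]_n) :
  psdmx A -> \tr A = (complex.Re (\tr A))%:C.
Proof. by case/psdmx_unidiag=> P [d [uP _ ->]]; rewrite mxtrace_unidiag. Qed.

(** Dividing the eigenvalues by [t] shifts each logarithm by [log2 t], and the weights sum to [t].
    For [t = 0] all eigenvalues vanish, in agreement with the omission of null outcomes in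
    [discord]. *)
Lemma entropy_normalized n (A : 'M[C]_n) : psdmx A ->
  let t := complex.Re (\tr A) in
  (if t != 0 then t * entropy ((t^-1)%:C *: A) else 0)
  = entropy A + t * log2 t.
Proof.
case/psdmx_unidiag=> P [d [uP d_ge0 ->]].
rewrite (mxtrace_unidiag d uP) /=; set t := \sum_i d i.
rewrite (entropy_unidiag d uP); case: eqVneq => [t0|t_n0] /=.
  rewrite t0 mul0r addr0 big1 ?oppr0 // => i _.
  by rewrite (psumr_eq0P (fun k _ => d_ge0 k) t0) // mul0r.
rewrite unidiagZ (entropy_unidiag _ uP) mulrN mulr_sumr /t mulr_suml -/t.
rewrite -sumrN -sumrN -big_split; apply: eq_bigr => i _ /=.
(* The logarithm of the product splits only for a positive eigenvalue; a zero one contributes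
   nothing to either side. *)
have := d_ge0 i; rewrite le0r => /predU1P[->|d_gt0];
  first by rewrite !(mulr0, mul0r) addr0.
have t_gt0 : 0 < t by rewrite lt0r t_n0 sumr_ge0.
rewrite /log2 lnM ?posrE ?invr_gt0 // lnV ?posrE //.
have := lt0r_neq0 (ln2_gt0 R); move: (ln 2) => l l_n0.
by field; rewrite l_n0 t_n0.
Qed.

Lemma outcome_probE k (X : 'M[C]_(dA * dB)) :
  outcome_prob e X k = complex.Re (\tr (cond_op e k X)).
Proof. by rewrite mxtrace_cond_op. Qed.

Lemma discord_dephasing (X : 'M[C]_(dA * dB)) : psdmx X ->
  discord e X = superdense_capacity X - superdense_capacity (dephasing e X).
Proof.
move=> X_psd; have tau_psd k := cond_op_psd e k X_psd.
rewrite /discord /superdense_capacity.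
suff -> : \sum_(k < dB | outcome_prob e X k != 0)
     outcome_prob e X k * entropy (post_state e X k) =
       cond_entropy (dephasing e X).
  move: (cond_entropy _) (cond_entropy _) (log2 _) => c c' l.
  lra.
rewrite /cond_entropy ptraceA_dephasing dephasingE.
rewrite (entropy_blocks e_basis tau_psd).
(* The marginal on [B] is diagonal in the measured basis with the outcome probabilities as
   eigenvalues; its entropy supplies the terms [t * log2 t] of [entropy_normalized]. *)
have -> : \sum_k \tr (cond_op e k X) *: ketbra (e k) =
    unidiag (basismx e) (outcome_prob e X).
  rewrite -sum_ketbra; apply: eq_bigr => k _.
  by rewrite outcome_probE -psdmx_trace_real.
rewrite (entropy_unidiag _ (basismx_unitary e_basis)) opprK -big_split
  big_mkcond.
apply: eq_bigr => k _; rewrite (post_stateE e_basis) outcome_probE.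
exact: entropy_normalized.
Qed.

Lemma quantumness_eq0P (L : {linear 'M[C]_(dA * dB) -> 'M[C]_(dA * dB)}) :
  (0 < dA * dB)%N -> quantum_operation L ->
  quantumness e L = 0%E <->
  (forall X : 'M[C]_(dA * dB), L (dephasing e X) = dephasing e (L X)).
Proof.
move=> n_gt0 L_op; split=> [W0|comm].
  apply: (density_ind n_gt0) => [a X Y LX LY|rho rho_d].
    by rewrite (dephasing_linear e) !linearP LX LY (dephasing_linear e).
  apply: rel_entropy_le0_eq.
  - exact/quantum_operation_density/dephasing_density.
  - exact/dephasing_density/quantum_operation_density.
  - by rewrite -W0; apply: ereal_sup_ubound; exists rho.
(* A state must exist, since the supremum over an empty set would be [-oo]; [density_ind] at a
   constant predicate yields one. *)
have [rho rho_d] : exists rho : 'M[C]_(dA * dB), density rho.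
  apply: (@density_ind R _ (fun=> exists rho, density rho) n_gt0 _ _ 0) => //.
  by move=> rho rho_d; exists rho.
rewrite /quantumness; set S := (X in ereal_sup X).
suff -> : S = [set 0%E]%classic by rewrite ereal_sup1.
apply/seteqP; split=> [_ [sigma _ <-]|_ ->] /=;
  first by rewrite comm rel_entropy_self.
by exists rho; rewrite // comm rel_entropy_self.
Qed.

End Discord.

(** The vectors [a i *t b i] are orthonormal, so their sum has squared norm [d], which the prefactor
    cancels. *)
Lemma maximally_entangled_density (R : realType) (dA dB d : nat)
    (a : 'I_d -> 'cV[R[i]]_dA) (b : 'I_d -> 'cV[R[i]]_dB) :
  (0 < dA)%N -> orthonormal_basis a -> orthonormal_basis b ->
  density (ketbra (maximally_entangled a b)).
Proof.
move=> dA_gt0 [a_on a_full] [b_on _]; split; first exact: psdmx_ketbra.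
(* The [d] vectors of [a] span a space of positive dimension [dA], so [dA <= d]. *)
have d_gt0 : (0 < d)%N.
  by apply: leq_trans dA_gt0 _; rewrite -(eqP a_full) rank_leq_row.
pose z : 'I_(1 * 1) := mxtens_index (0, 0).
pose u : 'M[R[i]]_(dA * dB, 1 * 1) := \sum_(i < d) a i *t b i.
have uu : (u^t* *m u) z z = d%:R.
  have -> : u^t* = \sum_(i < d) (a i)^t* *t (b i)^t*.
    apply/matrixP => x y; rewrite 2!mxE !summxE rmorph_sum.
    by apply: eq_bigr => i _; rewrite -trmxC_tens [RHS]mxE [in RHS]mxE.
  rewrite /u mulmx_suml summxE.
  rewrite -[d in RHS]card_ord -sumr_const; apply: eq_bigr => i _.
  rewrite mulmx_sumr summxE (bigD1 i) //= big1 => [|j ji].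
    by rewrite tensmx_mul tensmxE a_on b_on !mxE !eqxx !mulr1n mulr1 addr0.
  by rewrite tensmx_mul tensmxE a_on !mxE eq_sym (negPf ji) mul0rn mul0r.
rewrite /ketbra mxtrace_mulC trace_mx11 /maximally_entangled.
set s := Num.sqrt _; have -> : (\sum_(i < d) a i *t b i : 'cV_(dA * dB)) =
  u by [].
have s2 : s * s = d%:R by rewrite -expr2 sqr_sqrtr ?ler0n.
have uu0 : (u^t* *m u) 0 0 = d%:R.
  by rewrite -uu; have -> : z = 0 :> 'I_1 by exact: val_inj.
have s_n0 : s != 0 by rewrite lt0r_neq0 // sqrtr_gt0 ltr0n.
rewrite trmxCZ conjC_real -scalemxAl -scalemxAr 2!mxE uu0.
rewrite -(rmorph_nat (real_complex R)) -s2 -!rmorphM /=.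
by have -> : s^-1 * (s^-1 * (s * s)) = 1 by field.
Qed.

Theorem mainTheorem11 (R : realType) (dA dB : nat)
    (dA_gt0 : (0 < dA)%N) (dB_gt0 : (0 < dB)%N)
    (e : 'I_dB -> 'cV[R[i]]_dB) (e_basis : orthonormal_basis e)
    (L : {linear 'M[R[i]]_(dA * dB) -> 'M[R[i]]_(dA * dB)})
    (L_op : quantum_operation L) :
  (quantumness e L = 0%E <->
     (forall X : 'M[R[i]]_(dA * dB), L (dephasing e X) = dephasing e (L X)))
  /\
  (quantumness e L = 0%E ->
     (forall rho : 'M[R[i]]_(dA * dB), density rho ->
        discord e (L rho)
        = superdense_capacity (L rho) - superdense_capacity (L (dephasing e rho)))
     /\
     (forall (d : nat) (a : 'I_d -> 'cV[R[i]]_dA) (b : 'I_d -> 'cV[R[i]]_dB),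
        orthonormal_basis a -> orthonormal_basis b ->
        let Phi := ketbra (maximally_entangled a b) in
        discord e (L Phi)
        = superdense_capacity (L Phi) - superdense_capacity (L (dephasing e Phi)))).
Proof.
have n_gt0 : (0 < dA * dB)%N by rewrite muln_gt0 dA_gt0.
have W0P := quantumness_eq0P e_basis n_gt0 L_op.
split=> // /W0P comm.
suff main rho : density rho -> discord e (L rho)
    = superdense_capacity (L rho) - superdense_capacity (L (dephasing e rho)).
  by split=> // d a b a_on b_on; exact/main/maximally_entangled_density.
move=> rho_d; rewrite comm.
by apply: discord_dephasing; have [] := quantum_operation_density L_op rho_d.
Qed.
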